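(* Let $I$ be a closed ideal in a Banach algebra $A$ and suppose that $I$ admits a quasi-central approximate identity in $A$. Then $$\overline{[I,I]}=\overline{[I,A]}=I\cap\overline{[A,A]}.$$ In particular, $N(\overline{[I,A]})=N(I)$ and, if $A$ has no tracial functionals, then $\overline{[I,A]}=I$. Moreover, if the closed ideal $J:=\overline{\mathrm{Id}[I,A]}$ also contains a quasi-central approximate identity (for $J$ in $A$), then $\overline{[I,A]}=\overline{[J,A]}$.
   Context: All algebras are complex and ideals are two-sided. For elements $x,y$, $[x,y]:=xy-yx$; for subspaces $X,Y$ of $A$, $[X,Y]:=\mathrm{span}\{[x,y]:x\in X,\,y\in Y\}$. For a subset $S$ of $A$, $\mathrm{Id}\,S$ denotes the ideal of $A$ generated by $S$. For a subspace $S\subseteq A$, $N(S):=\{x\in A:[x,a]\in S\text{ for all }a\in A\}$. Bars denote norm closures. A tracial functional on a Banach algebra $A$ is a non-zero continuous linear functional $\varphi$ with $\varphi(ab)=\varphi(ba)$ for all $a,b\in A$. A quasi-central approximate identity for an ideal $I$ in a Banach algebra $A$ is a net $\{e_\lambda\}$ in $I$ with $\sup_\lambda\|e_\lambda\|<\infty$ and $\lim_\lambda\|xe_\lambda-x\|=\lim_\lambda\|e_\lambda x-x\|=\lim_\lambda\|e_\lambda a-ae_\lambda\|=0$ for all $x\in I$, $a\in A$. *)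

(* Defs.v *)
From HB Require Import structures.
From mathcomp Require Import all_boot all_order all_algebra complex.
From mathcomp Require Import all_classical all_reals all_analysis.

Set Implicit Arguments.
Unset Strict Implicit.
Unset Printing Implicit Defensive.

Import Order.TTheory GRing.Theory Num.Theory.
Import numFieldNormedType.Exports.

Local Open Scope classical_set_scope.
Local Open Scope ring_scope.

(* MathComp rings are unital, whereas a Banach algebra need not have a unit, so
   the product is an additional operation on a complete normed module. *)
HB.mixin Record CompleteNormedModule_isBanachAlgebra (K : numFieldType) A
    of CompleteNormedModule K A := {
  bmul : A -> A -> A;
  bmulA : associative bmul;
  bmulDl : left_distributive bmul +%R;
  bmulDr : right_distributive bmul +%R;
  bscalerAl : forall (k : K) (x y : A), k *: bmul x y = bmul (k *: x) y;
  bscalerAr : forall (k : K) (x y : A), k *: bmul x y = bmul x (k *: y);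
  ler_norm_bmul : forall x y : A, `|bmul x y| <= `|x| * `|y|
}.

#[short(type="banachAlgType")]
HB.structure Definition BanachAlgebra (K : numFieldType) :=
  {A of CompleteNormedModule_isBanachAlgebra K A & CompleteNormedModule K A}.

Notation "x ** y" := (bmul x y) (at level 40, left associativity) : ring_scope.

Section BanachAlgebraDefs.
Variables (K : numFieldType) (A : banachAlgType K).
Implicit Types (x y a : A) (S X Y I : set A).

Definition linear_subspace S := submod_closed [in S].

Definition ideal I :=
  linear_subspace I /\ forall a x, I x -> I (a ** x) /\ I (x ** a).

Definition lspan S : set A := smallest linear_subspace S.

Definition idealgen S : set A := smallest ideal S.

Definition comm x y : A := x ** y - y ** x.

Definition commS X Y : set A := lspan [set comm x y | x in X & y in Y].

Definition Nset S : set A := [set x | forall a, S (comm x a)].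

Definition tracial_functional (phi : {linear A -> K^o}) :=
  [/\ continuous phi, exists a, phi a != 0 &
      forall a b, phi (a ** b) = phi (b ** a)].

Definition directed (L : Type) (le : L -> L -> Prop) :=
  [/\ [set: L] !=set0, forall l, le l l,
      forall l m n, le l m -> le m n -> le l n &
      forall l m, exists n, le l n /\ le m n].

(* The filter of eventual sets of a net indexed by (L, le). *)
Definition tails (L : Type) (le : L -> L -> Prop) : set_system L :=
  filter_from [set: L] (fun l => [set m | le l m]).

Definition quasicentral_approximate_identity I
    (L : Type) (le : L -> L -> Prop) (e : L -> A) :=
  [/\ directed le,
      forall l, I (e l),
      exists M : K, forall l, `|e l| <= M,
      forall x, I x ->
        `|x ** e l - x| @[l --> tails le] --> (0 : K) /\
        `|e l ** x - x| @[l --> tails le] --> (0 : K) &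
      forall a, `|e l ** a - a ** e l| @[l --> tails le] --> (0 : K)].

Definition has_quasicentral_approximate_identity I :=
  exists (L : Type) (le : L -> L -> Prop) (e : L -> A),
    quasicentral_approximate_identity I le e.

End BanachAlgebraDefs.

(* Main.v *)
Require Import Defs.
From HB Require Import structures.
From mathcomp Require Import all_boot all_order all_algebra complex.
From mathcomp Require Import all_classical all_reals all_analysis.
From mathcomp Require Import ring lra.

Set Implicit Arguments.
Unset Strict Implicit.
Unset Printing Implicit Defensive.

Import Order.TTheory GRing.Theory Num.Theory.
Import numFieldNormedType.Exports.

Local Open Scope classical_set_scope.
Local Open Scope ring_scope.

(** Let [e] be the quasi-central approximate identity of [I].  For [x] in [I],
    [comm x (e l ** a)] lies in [[I, I]] and tends to [comm x a].  For [y] in [I]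
    close to [z] in [[A, A]], [y] is close to [y ** e l], hence to [z ** e l]; and
    [comm a b ** e l] differs from [comm a (b ** e l)], which lies in [[A, I]], by
    [b ** (e l ** a - a ** e l)], which tends to 0.  If there is no tracial
    functional, the Hahn-Banach theorem gives [closure [A, A] = A], since a
    functional vanishing on the commutators is tracial.  The last claim is the
    formula [closure [J, A] = J `&` closure [A, A]] for [J].  *)

(** * Hahn-Banach theorem for sublinear functionals on real vector spaces *)

Section HahnBanach.
Variables (R : realType) (V : lmodType R).
Implicit Types (p q : V -> R) (x y z : V).

(** Homogeneity is only an inequality for [r > 0], which is what an infimum inherits easily;
    applying it to [r^-1] too gives equality. *)
Definition sublinear p :=
  (forall x y, p (x + y) <= p x + p y) /\
  (forall (r : R) x, 0 < r -> p (r *: x) <= r * p x).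

Lemma sublinear0 p : sublinear p -> p 0 = 0.
Proof.
move=> [pD pZ]; apply/eqP; rewrite eq_le; apply/andP; split.
  have := pZ 2^-1 0; rewrite scaler0 invr_gt0 ltr0n => /(_ isT); lra.
by have := pD 0 0; rewrite addr0; lra.
Qed.

Lemma sublinearN_ge p x : sublinear p -> - p (- x) <= p x.
Proof. by move=> sp; have := sp.1 x (- x); rewrite subrr sublinear0 //; lra. Qed.

Lemma sublinearZ p (r : R) x : sublinear p -> 0 <= r -> p (r *: x) = r * p x.
Proof.
move=> sp; rewrite le_eqVlt => /orP[/eqP<-|r0].
  by rewrite scale0r mul0r sublinear0.
apply/eqP; rewrite eq_le sp.2 //=.
have := sp.2 r^-1 (r *: x); rewrite invr_gt0 scalerA mulVf ?gt_eqF// scale1r.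
by move=> /(_ r0); rewrite ler_pdivlMl.
Qed.

(** Serves tilts, chains in Zorn's lemma and the distance to a subspace. The index [k] may depend on
    the vectors, so no single member need be sublinear. *)
Lemma inf_sublinear (J : Type) (g : J -> V -> R) :
  [set: J] !=set0 -> (forall x, has_lbound (range (g^~ x))) ->
  (forall i j x y, exists k, g k (x + y) <= g i x + g j y) ->
  (forall i (r : R) x, 0 < r -> exists k, g k (r *: x) <= r * g i x) ->
  sublinear (fun x => inf (range (g^~ x))).
Proof.
move=> [j0 _] glb gD gZ.
have infle x k : inf (range (g^~ x)) <= g k x by apply: ge_inf => //; exists k.
have leinf x c : (forall k, c <= g k x) -> c <= inf (range (g^~ x)).
  by move=> h; apply: lb_le_inf; [exists (g j0 x), j0|move=> _ [k _ <-]].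
split=> [x y|r x r0].
  rewrite -lerBlDr; apply: (leinf) => i; rewrite lerBlDr -lerBlDl.
  apply: (leinf) => j; rewrite lerBlDl.
  by have [k] := gD i j x y; apply: le_trans.
rewrite -ler_pdivrMl //; apply: (leinf) => i; rewrite ler_pdivrMl //.
by have [k] := gZ i r x r0; apply: le_trans.
Qed.

(* The largest sublinear functional below [p] with value [- p y] at [- y]. *)
Definition tilt p y x :=
  inf (range (fun t : {nonneg R} => p (x + t%:num *: y) - t%:num * p y)).

Lemma tilt_bound p y x : sublinear p ->
  has_lbound (range (fun t : {nonneg R} => p (x + t%:num *: y) - t%:num * p y)).
Proof.
move=> sp; exists (- p (- x)) => _ [t _ <-].
have := sp.1 (x + t%:num *: y) (- x).
by rewrite addrAC subrr add0r sublinearZ //; lra.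
Qed.

Lemma tilt_sublinear p y : sublinear p -> sublinear (tilt p y).
Proof.
move=> sp; apply: inf_sublinear.
- by exists 0%:nng.
- by move=> x; exact: tilt_bound.
(* Parameters add under sums of vectors and scale by [r] under dilation. *)
- move=> s t x z; exists (s%:num + t%:num)%:nng => /=.
  have := sp.1 (x + s%:num *: y) (z + t%:num *: y).
  by rewrite scalerDl addrACA; lra.
- move=> t r x r0.
  have rt0 : 0 <= r * t%:num by rewrite mulr_ge0 // ltW.
  exists (NngNum rt0) => /=.
  have := sp.2 r (x + t%:num *: y) r0.
  by rewrite scalerDr scalerA; lra.
Qed.

Lemma tilt_le p y (t : R) x : sublinear p -> 0 <= t ->
  tilt p y x <= p (x + t *: y) - t * p y.
Proof.
by move=> sp t0; apply: ge_inf; [exact: tilt_bound|exists (NngNum t0)].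
Qed.

Lemma tilt_le_self p y x : sublinear p -> tilt p y x <= p x.
Proof.
move=> sp; have := tilt_le y x sp (lexx 0).
by rewrite scale0r addr0 mul0r subr0.
Qed.

(** Zorn's lemma for the reversed pointwise order: the pointwise infimum of a nonempty chain is
    again sublinear and bounds the chain. *)
Lemma minimal_sublinear p : sublinear p -> exists q,
  [/\ sublinear q, forall x, q x <= p x &
      forall s, sublinear s -> (forall x, s x <= q x) -> s = q].
Proof.
move=> sp; pose P q := sublinear q /\ forall x, q x <= p x; pose T := {q | P q}.
pose below (q s : T) := `[< forall x, sval s x <= sval q x >].
have /Zorn : forall t, below t t by move=> t; apply/asboolP.
case=> [r s t /asboolP rs /asboolP st|s t /asboolP st /asboolP ts|
  Q Qtot|q qmin].
- by apply/asboolP => x; exact: le_trans (st x) (rs x).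
- apply: eq_sig_hprop => [? ? ?|]; first exact: Prop_irrelevance.
  apply/funext => x; apply/eqP.
  by rewrite eq_le st ts.
(* The empty chain is bounded by [p] itself. *)
- have [[q0 Qq0]|Q0] := pselect (Q !=set0); last first.
    exists (exist P p (conj sp (fun x => lexx _))) => s Qs.
    by case: Q0; exists s.
  pose g (q : {q | Q q}) := sval (sval q).
  (* The infimum is finite because [- p (- x) <= - q (- x) <= q x] for every [q] in the chain. *)
  have glb x : has_lbound (range (g^~ x)).
    exists (- p (- x)) => _ [[[q [sq qp]] Qq] _ <-] /=.
    apply: le_trans (sublinearN_ge _ sq); rewrite lerN2; exact: qp.
  have sg : sublinear (fun x => inf (range (g^~ x))).
    apply: inf_sublinear => //; first by exists (exist _ q0 Qq0).
      move=> [q Qq] [s Qs] x y; rewrite /g/=.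
      (* The smaller of the two functionals serves as the common index. *)
      case: (Qtot q s Qq Qs) => /asboolP h.
        exists (exist _ s Qs) => /=; apply: le_trans ((svalP s).1.1 x y) _.
        by rewrite lerD2r.
      exists (exist _ q Qq) => /=; apply: le_trans ((svalP q).1.1 x y) _.
      by rewrite lerD2l.
    by move=> q r x r0; exists q; apply: (svalP (sval q)).1.2.
  have gle (q : T) x : Q q -> inf (range (g^~ x)) <= sval q x.
    by move=> Qq; apply: ge_inf => //; exists (exist _ q Qq).
  have gp x : inf (range (g^~ x)) <= p x.
    exact: le_trans (gle _ x Qq0) ((svalP q0).2 x).
  exists (exist P _ (conj sg gp)) => q Qq; apply/asboolP => x; exact: gle.
- case: q qmin => q [sq qp] qmin; exists q; split=> // s ss sq'.
  have sp' x : s x <= p x by exact: le_trans (sq' x) (qp x).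
  have /qmin/(congr1 sval) :
      below (exist P q (conj sq qp)) (exist P s (conj ss sp')) by exact/asboolP.
  by [].
Qed.

(* A minimal sublinear [q] is linear: [q x = tilt q y x <= q (x + y) - q y]. *)
Lemma hahn_banach p : sublinear p ->
  exists f : {scalar V}, forall x, f x <= p x.
Proof.
move=> /minimal_sublinear[q [sq qp qmin]].
have qD x y : q (x + y) = q x + q y.
  apply/eqP; rewrite eq_le sq.1 //=.
  have tq : tilt q y = q.
    by apply: qmin => [|z]; [exact: tilt_sublinear|exact: tilt_le_self].
  by have := tilt_le y x sq ler01; rewrite tq scale1r mul1r; lra.
have qN x : q (- x) = - q x.
  by have := qD x (- x); rewrite subrr (sublinear0 sq) => h; lra.
have q_scalar : scalar q.
  move=> r x y; rewrite qD; congr (_ + _).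
  have [r0|r0] := leP 0 r; first exact: sublinearZ.
  by rewrite -[r]opprK scaleNr qN sublinearZ ?oppr_ge0 ?(ltW r0)// [RHS]mulNr.
pose f := HB.pack q (GRing.isLinear.Build R V R^o *%R q q_scalar) : {scalar V}.
by exists f.
Qed.

(** A linear [f] below [tilt p x0] satisfies [f (- x0) <= p 0 - p x0], hence [p x0 <= f x0]. *)
Corollary hahn_banach_peak p x0 : sublinear p ->
  exists f : {scalar V}, (forall x, f x <= p x) /\ f x0 = p x0.
Proof.
move=> sp; have [f ftilt] := hahn_banach (tilt_sublinear x0 sp).
have fp x : f x <= p x by exact: le_trans (ftilt x) (tilt_le_self _ _ sp).
exists f; split=> //; apply/eqP; rewrite eq_le fp /=.
have := le_trans (ftilt (- x0)) (tilt_le x0 (- x0) sp ler01).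
by rewrite scale1r addNr sublinear0 // raddfN /=; lra.
Qed.
End HahnBanach.

(** * Passage between real-linear and complex-linear functionals *)

Section RestrictScalars.
Variable R : rcfType.
Local Open Scope complex_scope.

(** A type synonym, so that the real module structure does not compete with the complex one on
    [V]. *)
Definition restrict_scalars (V : lmodType R[i]) : Type := V.

Variable V : lmodType R[i].
Implicit Types (r s : R) (v : restrict_scalars V).

HB.instance Definition _ := GRing.Zmodule.on (restrict_scalars V).

Let rscale r v : restrict_scalars V := r%:C *: (v : V).

Let rscaleA r s v : rscale r (rscale s v) = rscale (r * s) v.
Proof. by rewrite /rscale scalerA rmorphM. Qed.

Let rscale1 : left_id 1 rscale.
Proof. by move=> v; rewrite /rscale rmorph1 scale1r. Qed.

Let rscaleDr : right_distributive rscale +%R.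
Proof. by move=> r v w; rewrite /rscale scalerDr. Qed.

Let rscaleDl v : {morph rscale^~ v : r s / r + s}.
Proof. by move=> r s; rewrite /rscale rmorphD scalerDl. Qed.

HB.instance Definition _ := GRing.Zmodule_isLmodule.Build R
  (restrict_scalars V) rscaleA rscale1 rscaleDr rscaleDl.

Variable f : {scalar restrict_scalars V}.

(** The only complex-linear functional with real part [f], as the imaginary part at [v] must be
    minus the real part at [i v]. *)
Definition complexify (v : V) : R[i]^o := f v +i* - f ('i%C *: v).

Lemma complexify_is_linear : linear complexify.
Proof.
have fD (v w : V) : f (v + w) = f v + f w by exact: linearD.
have fZ (b : R) (v : V) : f (b%:C *: v) = b * f v by exact: (linearZ_LR f).
have fZC (b c : R) (v : V) : f ((b +i* c) *: v) = b * f v + c * f ('i%C *: v).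
  have -> : (b +i* c) *: v = b%:C *: v + c%:C *: ('i%C *: v).
    by rewrite scalerA -scalerDl; congr (_ *: _); simpc.
  by rewrite fD !fZ.
move=> [b c] v w; rewrite /complexify scalerDr !fD scalerA.
have iM : 'i%C * (b +i* c) = (- c) +i* b.
  by apply/eqP; rewrite eq_complex /= !mul0r !mul1r sub0r add0r !eqxx.
rewrite iM (fZC b c v) (fZC (- c) b v).
have E (x y z t : R) :
    (b +i* c) *: ((x +i* y) : R[i]^o) + (z +i* t) =
    (b * x - c * y + z) +i* (b * y + c * x + t) by [].
by rewrite E; congr (_ +i* _); ring.
Qed.

HB.instance Definition _ :=
  GRing.isLinear.Build R[i] V R[i]^o *:%R complexify complexify_is_linear.

End RestrictScalars.

(** * Linear subspaces and their closures *)

Lemma submod_closedP (K : nzRingType) (V : lmodType K) (S : set V) :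
  submod_closed [in S] <->
  S 0 /\ forall (k : K) x y, S x -> S y -> S (k *: x + y).
Proof.
split=> [[S0 SD]|[S0 SD]]; split.
- by move: S0; rewrite inE.
- by move=> k x y Sx Sy; have := SD k x y; rewrite !inE; apply.
- by rewrite inE.
- by move=> k x y; rewrite !inE; apply: SD.
Qed.

Section Closure.
Variables (K : numFieldType) (V : normedModType K).
Implicit Types (S : set V) (x : V).

Lemma closure_normP S x :
  closure S x <-> forall eps : K, 0 < eps -> exists2 y, S y & `|x - y| < eps.
Proof.
split=> [Sx eps eps0|h B /nbhs_ballP[eps /= eps0 epsB]].
  have [y [Sy /=]] := Sx _ (nbhsx_ballx x eps eps0).
  by rewrite -ball_normE => xy; exists y.
have [y Sy xy] := h _ eps0; exists y; split=> //.
by apply: epsB; rewrite -ball_normE.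
Qed.

Lemma closure_submod S : submod_closed [in S] -> submod_closed [in closure S].
Proof.
move=> /submod_closedP[S0 SD]; apply/submod_closedP; split.
  exact: subset_closure.
move=> k x y /closure_normP Sx /closure_normP Sy; apply/closure_normP => e e0.
(* Dividing by [|k| + 1] rather than [|k|] covers [k = 0]. *)
have k1 : 0 < `|k| + 1 by rewrite ltr_wpDl.
have e20 : 0 < e / 2 by rewrite divr_gt0.
have [x' Sx' xx'] := Sx (e / 2 / (`|k| + 1)) (divr_gt0 e20 k1).
have [y' Sy' yy'] := Sy (e / 2) e20.
exists (k *: x' + y'); first exact: SD.
rewrite opprD addrACA -scalerBr [e]splitr.
rewrite (le_lt_trans (ler_normD _ _))// ltr_leD// ?(ltW yy')// normrZ.
rewrite (le_lt_trans (y := (`|k| + 1) * `|x - x'|))//.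
  by rewrite ler_wpM2r// lerDl.
by rewrite mulrC -ltr_pdivlMr.
Qed.
End Closure.

(** * Separating a point from a closed complex subspace *)

Section Separation.
Variables (R : realType) (V : normedModType R[i]) (D : set V).
Hypothesis subD : submod_closed [in D].
Local Open Scope complex_scope.

(** Norms on [V] have values in [R[i]]; the real Hahn-Banach theorem needs values in [R]. *)
Let renorm (x : V) : R := complex.Re `|x|.

Let renormK (x : V) : (renorm x)%:C = `|x|.
Proof. exact/RRe_real/normr_real. Qed.

Let renorm_ge0 x : 0 <= renorm x.
Proof. by rewrite -ler0c renormK. Qed.

Let renormD x y : renorm (x + y) <= renorm x + renorm y.
Proof. by rewrite -lecR rmorphD /= !renormK ler_normD. Qed.

Let renormZ (k : R[i]) x : (renorm (k *: x))%:C = `|k| * (renorm x)%:C.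
Proof. by rewrite !renormK normrZ. Qed.

(** The quotient seminorm of [V] modulo [D]. *)
Let dist (x : restrict_scalars V) : R :=
  inf (range (fun d : {d | D d} => renorm ((x : V) - sval d))).

Let dist_lb (x : restrict_scalars V) :
  has_lbound (range (fun d : {d | D d} => renorm ((x : V) - sval d))).
Proof. by exists 0 => _ [d _ <-]. Qed.

Let dist_le (x d : V) : D d -> dist x <= renorm (x - d).
Proof. by move=> Dd; apply: ge_inf => //; exists (exist _ d Dd). Qed.

Let dist_sublinear : sublinear dist.
Proof.
have [D0 DD] := (submod_closedP D).1 subD.
apply: inf_sublinear => //; first by exists (exist _ 0 D0).
  move=> [d Dd] [d' Dd'] x y.
  have Ddd : D (d + d') by have := DD 1 _ _ Dd Dd'; rewrite scale1r.
  by exists (exist _ _ Ddd) => /=; rewrite opprD addrACA renormD.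
move=> [d Dd] r x r0.
have Drd : D (r%:C *: d) by have := DD r%:C _ _ Dd D0; rewrite addr0.
exists (exist _ _ Drd) => /=.
have -> : (r *: x : V) - r%:C *: d = r%:C *: ((x : V) - d) by rewrite scalerBr.
by rewrite -lecR renormZ rmorphM /= ger0_norm// lecR ltW.
Qed.

(** Take a real functional [f <= dist] with [f x0 = dist x0 > 0]. As [dist] is at most the norm and
    vanishes on [D], [f] is bounded and zero on [D]; then complexify. *)
Lemma functional_separation x0 : ~ closure D x0 ->
  exists phi : {linear V -> R[i]^o},
    [/\ continuous phi, forall d, D d -> phi d = 0 & phi x0 != 0].
Proof.
move=> Dx0.
have [D0 DD] := (submod_closedP D).1 subD.
have dist_gt0 : 0 < dist x0.
  have [e [e0 eD]] : exists e : R[i], 0 < e /\ forall d, D d -> e <= `|x0 - d|.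
    apply: contrapT => h; apply: Dx0; apply/closure_normP => e e0.
    apply: contrapT => h'; apply: h; exists e; split=> // d Dd.
    (* The order on [R[i]] is partial, so negating an inequality requires both sides to be real. *)
    rewrite real_leNgt ?ger0_real ?(ltW e0)//; apply/negP => de.
    by apply: h'; exists d.
  have eE : (complex.Re e)%:C = e by exact/RRe_real/gtr0_real.
  apply: (@lt_le_trans _ _ (complex.Re e)); first by rewrite -ltcR eE.
  apply: lb_le_inf; first by exists (renorm (x0 - 0)), (exist _ 0 D0).
  by move=> _ [[d Dd] _ <-] /=; rewrite -lecR eE renormK eD.
have [f [f_le fx0]] :=
  hahn_banach_peak (x0 : restrict_scalars V) dist_sublinear.
have f_norm (x : V) : `|(f x)%:C| <= `|x|.
  have fn (y : V) : f y <= renorm y.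
    by apply: le_trans (f_le y) _; rewrite -[y in renorm y]subr0 dist_le.
  have frenorm : `|f x| <= renorm x.
    rewrite ler_norml fn andbT lerNl -(raddfN f).
    by apply: le_trans (fn _) _; rewrite /renorm normrN.
  rewrite real_ler_norml ?complex_real// -renormK -rmorphN !lecR.
  by rewrite -ler_norml.
(* Real and imaginary parts are each bounded by the norm of [x]; this crude constant suffices for
   continuity. *)
have phi_norm (x : V) : `|complexify f x : R[i]| <= 2 * `|x|.
  have -> : complexify f x = (f x)%:C - 'i%C * (f ('i%C *: x))%:C.
    by rewrite /complexify; simpc.
  rewrite (le_trans (ler_normB _ _))// mulrDl mul1r lerD// normrM.
  have i1 : `|'i%C : R[i]| = 1.
    by rewrite normc_def /= expr0n /= add0r expr1n sqrtr1.
  by rewrite i1 mul1r (le_trans (f_norm _))// normrZ i1 mul1r.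
have fD (x : V) : D x -> f x = 0.
  have fle0 (y : V) : D y -> f y <= 0.
    move=> Dy; apply: le_trans (f_le y) _.
    by apply: le_trans (dist_le y Dy) _; rewrite subrr /renorm normr0.
  move=> Dx; apply/eqP; rewrite eq_le fle0//=.
  rewrite -oppr_le0 -(raddfN f); apply: fle0.
  by have := DD (-1) _ _ Dx D0; rewrite addr0 scaleN1r.
exists (complexify f); split.
- apply/linear_bounded_continuous/linear_boundedP; near=> r => x.
  apply: le_trans (phi_norm x) _.
  by rewrite ler_wpM2r//; near: r; apply: nbhs_pinfty_ge; rewrite ger0_real.
- move=> d Dd.
  (* The imaginary part vanishes because [D] is stable under multiplication by [i]. *)
  have Did : D ('i%C *: d) by have := DD 'i%C _ _ Dd D0; rewrite addr0.
  by rewrite /= /complexify !fD // oppr0.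
- rewrite /= /complexify eq_complex /= negb_and fx0.
  by rewrite gt_eqF.
Unshelve. all: by end_near.
Qed.

End Separation.

(** * Closure and continuity criteria *)

Lemma closure_min (T : topologicalType) (S C : set T) :
  closed C -> S `<=` C -> closure S `<=` C.
Proof. by move=> /closure_id {2}-> SC; exact: closure_subset. Qed.

Lemma lipschitz_continuous (K : numFieldType) (V W : normedModType K)
    (f : V -> W) (c : K) : 0 <= c ->
  (forall x y, `|f x - f y| <= c * `|x - y|) -> continuous f.
Proof.
move=> c0 fL x; have c1 : 0 < c + 1 by rewrite ltr_wpDl.
apply/cvgrPdist_lt => e e0; near=> y.
apply: le_lt_trans (fL x y) _.
apply: (@le_lt_trans _ _ ((c + 1) * `|x - y|)).
  by rewrite ler_wpM2r// lerDl.
rewrite mulrC -ltr_pdivlMr//; near: y.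
by apply: cvgr_dist_lt => //; exact: divr_gt0.
Unshelve. all: by end_near.
Qed.

(** * Commutator spaces and ideals in a Banach algebra *)

Section CommutatorSpaces.
Variables (K : numFieldType) (A : banachAlgType K).
Implicit Types (S T X Y : set A) (x y a b : A).

Lemma lspan_linear_subspace S : linear_subspace (lspan S).
Proof.
apply/submod_closedP; split=> [T [/submod_closedP[T0 _] _]//|].
move=> k x y Sx Sy T [sT ST].
have /submod_closedP[_ TD] := sT.
by apply: TD; [exact: Sx|exact: Sy].
Qed.

Lemma comm_commS X Y x y : X x -> Y y -> commS X Y (comm x y).
Proof. by move=> Xx Yy; apply: sub_gen_smallest; exists x => //; exists y. Qed.

Lemma commS_sub X Y T : linear_subspace T ->
  (forall x y, X x -> Y y -> T (comm x y)) -> commS X Y `<=` T.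
Proof.
by move=> sT XYT; apply: smallest_sub => // _ [x Xx [y Yy <-]]; exact: XYT.
Qed.

Lemma commS_mono X X' Y Y' : X `<=` X' -> Y `<=` Y' ->
  commS X Y `<=` commS X' Y'.
Proof.
move=> XX' YY'; apply: commS_sub; first exact: lspan_linear_subspace.
by move=> x y Xx Yy; apply: comm_commS; [exact: XX'|exact: YY'].
Qed.

Lemma closure_commS_linear_subspace X Y :
  linear_subspace (closure (commS X Y)).
Proof. exact/closure_submod/lspan_linear_subspace. Qed.

Lemma bmulBl x y a : (x - y) ** a = x ** a - y ** a.
Proof. by apply: (addIr (y ** a)); rewrite -bmulDl !subrK. Qed.

Lemma bmulBr x y a : a ** (x - y) = a ** x - a ** y.
Proof. by apply: (addIr (a ** y)); rewrite -bmulDr !subrK. Qed.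

Lemma bmul0r x : 0 ** x = 0.
Proof. by rewrite -[0 in LHS](subrr x) bmulBl subrr. Qed.

Lemma bmulr0 x : x ** 0 = 0.
Proof. by rewrite -[0 in LHS](subrr x) bmulBr subrr. Qed.

Lemma bmulr_continuous a : continuous (fun x => x ** a).
Proof.
apply: (@lipschitz_continuous _ _ _ _ `|a|) => // x y.
by rewrite -bmulBl mulrC ler_norm_bmul.
Qed.

Lemma bmull_continuous a : continuous (fun x => a ** x).
Proof.
apply: (@lipschitz_continuous _ _ _ _ `|a|) => // x y.
by rewrite -bmulBr ler_norm_bmul.
Qed.

(** Multiplication by [a] is continuous, so the preimage of [closure S] is a closed set containing
    [S]. *)
Lemma closure_ideal S : ideal S -> ideal (closure S).
Proof.
move=> [sS idS]; split; first exact: closure_submod.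
move=> a x Sx; split; move: x Sx.
- apply: (@closure_min _ _ ((fun x => a ** x) @^-1` closure S)).
    move/continuous_closedP: (@bmull_continuous a); apply.
    exact: closed_closure.
  by move=> x Sx; apply: subset_closure; exact: (idS a x Sx).1.
- apply: (@closure_min _ _ ((fun x => x ** a) @^-1` closure S)).
    move/continuous_closedP: (@bmulr_continuous a); apply.
    exact: closed_closure.
  by move=> x Sx; apply: subset_closure; exact: (idS a x Sx).2.
Qed.

Lemma idealgen_ideal S : ideal (idealgen S).
Proof.
split.
  apply/submod_closedP; split=> [T [[/submod_closedP[T0 _] _] _]//|].
  move=> k x y Sx Sy T [iT ST]; have /submod_closedP[_ TD] := iT.1.
  by apply: TD; [exact: Sx|exact: Sy].
by move=> a x Sx; split=> T [iT ST]; have /(iT.2 a)[] := Sx T (conj iT ST).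
Qed.

Lemma commS_sub_ideal S : ideal S -> commS S [set: A] `<=` S.
Proof.
move=> [sS idS]; apply: (commS_sub sS) => x a Sx _; have [ax xa] := idS a x Sx.
have /submod_closedP[_ SD] := sS.
by have := SD (-1) _ _ ax xa; rewrite scaleN1r addrC.
Qed.

End CommutatorSpaces.

(** * Closed commutator spaces under a quasi-central approximate identity *)

Section QuasicentralApproximateIdentity.
Variables (K : numFieldType) (A : banachAlgType K) (I : set A).
Hypotheses (idealI : ideal I) (closedI : closed I).

Section Net.
Variables (L : Type) (le : L -> L -> Prop) (e : L -> A).
Hypothesis qcai : quasicentral_approximate_identity I le e.
Local Notation F := (tails le).

(** Reflexivity makes tails inhabited; directedness and transitivity put a tail inside any
    intersection of two. *)
#[local] Instance tails_proper : ProperFilter F.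
Proof.
have [[L0 lexx letr ledir] _ _ _ _] := qcai.
apply: filter_from_proper => [|l _]; last by exists l; exact: lexx.
apply: filter_fromT_filter => [|l m]; first by have [l _] := L0; exists l.
have [n [ln mn]] := ledir l m; exists n => p /= np.
by split; [exact: letr np|exact: letr np].
Qed.

Let mem_e l : I (e l).
Proof. by have [] := qcai. Qed.

Let cvg_mule x : I x -> x ** e l @[l --> F] --> x.
Proof.
move=> Ix; apply/subr_cvg0; apply: norm_cvg0.
by have [_ _ _ /(_ _ Ix)[]] := qcai.
Qed.

Let cvg_emul x : I x -> e l ** x @[l --> F] --> x.
Proof.
move=> Ix; apply/subr_cvg0; apply: norm_cvg0.
by have [_ _ _ /(_ _ Ix)[]] := qcai.
Qed.

Let cvg_comme a : e l ** a - a ** e l @[l --> F] --> (0 : A).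
Proof. by apply: norm_cvg0; have [_ _ _ _] := qcai; apply. Qed.

Let closure_commS_IA_sub : closure (commS I [set: A]) `<=` closure (commS I I).
Proof.
apply: (closure_min (@closed_closure _ _)); apply: commS_sub.
  exact: closure_commS_linear_subspace.
move=> x a Ix _; have [Iax Ixa] := idealI.2 a x Ix.
apply: (@closed_cvg _ _ F _ (fun l => comm x (e l ** a)) (closure (commS I I))
  (@closed_closure _ _)).
  apply: nearW => l; apply: subset_closure; apply: comm_commS => //.
  exact: (idealI.2 a _ (mem_e l)).2.
(* After reassociation, [(x ** e l) ** a] tends to [x ** a], and [e l ** (a ** x)] to [a ** x] since
   [a ** x] lies in [I]. *)
rewrite /comm; apply: cvgB.
  under eq_fun do rewrite bmulA.
  apply: (@continuous_cvg _ _ _ F _ _ (bmul^~ a)); last exact: cvg_mule.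
  exact: bmulr_continuous.
by under eq_fun do rewrite -bmulA; exact: cvg_emul.
Qed.

(** The existence of such a net [w] is stable under linear combinations of [z], which leaves a
    single commutator to treat. *)
Let commS_cvg z : commS [set: A] [set: A] z ->
  exists2 w : L -> A, forall l, commS I [set: A] (w l) &
    z ** e l - w l @[l --> F] --> (0 : A).
Proof.
have /submod_closedP[S0 SD] := lspan_linear_subspace
  [set comm x y | x in I & y in [set: A]].
move: z; apply: commS_sub.
  apply/submod_closedP; split.
    exists (fun=> 0) => [_|]; first exact: S0.
    by under eq_fun do rewrite bmul0r subrr; exact: cvg_cst.
  move=> k x y [v Sv cv] [w Sw cw]; exists (fun l => k *: v l + w l).
    by move=> l; exact: SD (Sv l) (Sw l).
  have E l : (k *: x + y) ** e l - (k *: v l + w l) =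
      k *: (x ** e l - v l) + (y ** e l - w l).
    by rewrite bmulDl -bscalerAl opprD addrACA scalerBr.
  under eq_fun do rewrite E.
  have := cvgD (cvgZ (cvg_cst k) cv) cw.
  by rewrite scaler0 addr0; apply.
(* This is [comm a (b ** e l)], written with the element of [I] first to match [commS I
   [set: A]]. *)
move=> a b _ _; exists (fun l => - comm (b ** e l) a).
  move=> l; have := SD (-1) (comm (b ** e l) a) 0.
  rewrite addr0 scaleN1r; apply=> //; apply: comm_commS => //.
  exact: (idealI.2 b _ (mem_e l)).1.
have E l : comm a b ** e l - - comm (b ** e l) a = b ** (e l ** a - a ** e l).
  rewrite opprK /comm bmulBl bmulBr !bmulA addrC.
  by rewrite addrA addrNK.
under eq_fun do rewrite E.
have := @continuous_cvg _ _ _ F _ _ (bmul b) 0 (@bmull_continuous _ _ b _)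
  (cvg_comme a).
by rewrite bmulr0; apply.
Qed.

Let closure_commS_AA_sub :
  I `&` closure (commS [set: A] [set: A]) `<=` closure (commS I [set: A]).
Proof.
move=> y [Iy /closure_normP Sy]; apply/closure_normP => eps eps0.
have [_ _ [M eM] _ _] := qcai.
have [l0 _] := filter_ex (@filterT _ F _).
have M0 : 0 <= M by exact: le_trans (eM l0).
have M1 : 0 < M + 1 by rewrite ltr_wpDl.
have eps3 : 0 < eps / 3 by rewrite divr_gt0.
(* [z] is fixed before [l]: with this tolerance [(y - z) ** e l] stays below [eps / 3] for all [l],
   since [M] bounds the net. The other two terms of the splitting below tend to 0. *)
have [z Sz yz] := Sy _ (divr_gt0 eps3 M1).
have [w Iw cw] := commS_cvg Sz.
have : \forall l \near F, `|y - w l| < eps.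
  near=> l.
  have -> : y - w l = (y - y ** e l) + ((y - z) ** e l) + (z ** e l - w l).
    by rewrite bmulBl !addrA !subrK.
  have -> : eps = eps / 3 + eps / 3 + eps / 3 by field.
  apply: le_lt_trans (ler_normD _ _) _; apply: ltrD; last first.
    by near: l; exact: cvgr0_norm_lt.
  apply: le_lt_trans (ler_normD _ _) _; apply: ltrD.
    by near: l; apply: cvgr_dist_lt => //; exact: cvg_mule.
  apply: le_lt_trans (ler_norm_bmul _ _) _.
  apply: (@le_lt_trans _ _ (`|y - z| * (M + 1))).
    by rewrite ler_wpM2l// (le_trans (eM l))// lerDl.
  by rewrite -ltr_pdivlMr.
by move=> /filter_ex[l yw]; exists (w l).
Unshelve. all: by end_near.
Qed.

Lemma qcai_closure_commS :
  closure (commS I I) = closure (commS I [set: A]) /\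
  closure (commS I [set: A]) = I `&` closure (commS [set: A] [set: A]).
Proof.
split; apply/seteqP; split=> //.
- by apply: closure_subset; exact: commS_mono.
- move=> x Ix; split; last by apply: closure_subset Ix; exact: commS_mono.
  exact: (closure_min closedI (commS_sub_ideal idealI)) Ix.
Qed.

End Net.

Lemma closure_commS_self : has_quasicentral_approximate_identity I ->
  closure (commS I I) = closure (commS I [set: A]).
Proof. by move=> [L [le [e /qcai_closure_commS[]]]]. Qed.

Lemma closure_commS_setI : has_quasicentral_approximate_identity I ->
  closure (commS I [set: A]) = I `&` closure (commS [set: A] [set: A]).
Proof. by move=> [L [le [e /qcai_closure_commS[]]]]. Qed.

End QuasicentralApproximateIdentity.

(** * Absence of tracial functionals, and the theorem *)

Lemma closure_commSTT (R : realType) (A : banachAlgType R[i]) :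
  (~ exists phi : {linear A -> R[i]^o}, tracial_functional phi) ->
  closure (commS [set: A] [set: A]) = [set: A].
Proof.
move=> notrace; apply/seteqP; split=> // x _; apply: contrapT => Sx.
have [phi [cphi phi0 phix]] :=
  functional_separation (lspan_linear_subspace _) Sx.
apply: notrace; exists phi; split=> //; first by exists x.
move=> a b; apply/eqP; rewrite -subr_eq0 -raddfB; apply/eqP/phi0.
exact: comm_commS.
Qed.

Theorem lemma4p2 (R : realType) (A : banachAlgType R[i]) (I : set A)
    (idealI : ideal I) (closedI : closed I)
    (qcaiI : has_quasicentral_approximate_identity I) :
  let J := closure (idealgen (commS I [set: A])) in
  [/\ closure (commS I I) = closure (commS I [set: A]),
      closure (commS I [set: A]) = I `&` closure (commS [set: A] [set: A]),
      Nset (closure (commS I [set: A])) = Nset I,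
      (~ exists phi : {linear A -> R[i]^o}, tracial_functional phi) ->
        closure (commS I [set: A]) = I &
      has_quasicentral_approximate_identity J ->
        closure (commS I [set: A]) = closure (commS J [set: A])].
Proof.
move=> J; have IE := closure_commS_setI idealI closedI qcaiI.
split=> //.
- exact: closure_commS_self.
(* Every [comm x a] lies in [[A, A]], so only membership in [I] is a condition. *)
- rewrite IE; apply/seteqP; split=> x Nx a; first by have [] := Nx a.
  by split; [exact: Nx|apply: subset_closure; exact: comm_commS].
- by move=> /closure_commSTT AE; rewrite IE AE setIT.
- have idealJ : ideal J by exact/closure_ideal/idealgen_ideal.
  have closedJ : closed J by exact: closed_closure.
  move=> /(closure_commS_setI idealJ closedJ) JE; apply/seteqP; split.
  + rewrite JE => x Ix; split.
      by apply: closure_subset Ix; exact: sub_gen_smallest.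
    by apply: closure_subset Ix; exact: commS_mono.
  + apply: closure_subset; apply: commS_mono => //.
    (* [J] is contained in [I], a closed ideal containing [[I, A]]. *)
    apply: (closure_min closedI); apply: smallest_sub => //.
    exact: commS_sub_ideal.
Qed.
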